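(* Let $\mathbf{X}_1,\dots,\mathbf{X}_n\in\mathbb{R}^d$ and suppose the loss $\rho$ satisfies: (A1) $\rho$ is non-decreasing, $\rho(0)=0$, and $\rho(x)/x\to 0$ as $x\to 0$; (A2) $\varphi(0)\triangleq\lim_{x\to 0}\psi(x)/x$ exists and is finite; (A3) $\psi$ and $\varphi$ are continuous; and suppose $\varphi$ is nonincreasing. Suppose moreover that $J(g)=\frac1n\sum_{i=1}^n\rho(\|\Phi(\mathbf{X}_i)-g\|_{\mathcal{H}})$ is strictly convex on $\mathcal{H}$. Then the sequence $\{f^{(k)}\}_{k=1}^\infty$ produced by the KIRWLS algorithm converges to $\widehat{f}_{RKDE}=\arg\min_{g\in\mathcal{H}}J(g)$ in the $\mathcal{H}$-norm.
   Context: The kernel $k_\sigma:\mathbb{R}^d\times\mathbb{R}^d\to[0,\infty)$ satisfies $\int k_\sigma(\mathbf{x},\cdot)\,d\mathbf{x}=1$, is radial, meaning $k_\sigma(\mathbf{x},\mathbf{x}')=g_0(\|\mathbf{x}-\mathbf{x}'\|^2)$ for some function $g_0$, and is positive semi-definite. $\mathcal{H}$ is the reproducing kernel Hilbert space (real) associated with $k_\sigma$, and $\Phi(\mathbf{x})\triangleq k_\sigma(\cdot,\mathbf{x})\in\mathcal{H}$ is the canonical feature map. The loss $\rho:[0,\infty)\to\mathbb{R}$ is differentiable, $\psi\triangleq\rho'$, and $\varphi(x)\triangleq\psi(x)/x$ for $x>0$. The KIRWLS (kernelized iteratively re-weighted least squares) algorithm starts with initial weights $w_i^{(0)}\in\mathbb{R}$,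 $i=1,\dots,n$, with $w_i^{(0)}\ge 0$ and $\sum_{i=1}^n w_i^{(0)}=1$, and generates $\{f^{(k)}\}_{k\ge1}$ by iterating $$f^{(k)}=\sum_{i=1}^n w_i^{(k-1)}\Phi(\mathbf{X}_i),\qquad w_i^{(k)}=\frac{\varphi(\|\Phi(\mathbf{X}_i)-f^{(k)}\|_{\mathcal{H}})}{\sum_{j=1}^n\varphi(\|\Phi(\mathbf{X}_j)-f^{(k)}\|_{\mathcal{H}})}.$$ *)

(* Defs.v *)
From HB Require Import structures.
From mathcomp Require Import all_boot all_order all_algebra.
From mathcomp Require Import all_classical all_reals all_analysis.

Set Implicit Arguments.
Unset Strict Implicit.
Unset Printing Implicit Defensive.

Import Order.TTheory GRing.Theory Num.Theory.
Import numFieldNormedType.Exports.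

Local Open Scope classical_set_scope.
Local Open Scope ring_scope.

(* Points of R^d are tuples rather than row vectors: tuples carry the product
   sigma-algebra. *)
Notation Rd R d := (d.-tuple (measurableTypeR R)).

Definition sqdist (R : realType) (d : nat) (x y : Rd R d) : R :=
  \sum_(i < d) ((tnth x i : R) - tnth y i) ^+ 2.

Section lebesgue_cons.
Context {R : realType} {d : nat}.

Definition tcons (p : measurableTypeR R * Rd R d) : Rd R d.+1 :=
  [tuple of p.1 :: p.2].

Lemma measurable_tcons : measurable_fun setT tcons.
Proof. by apply: measurable_cons. Qed.

Variable m : {sigma_finite_measure set (Rd R d) -> \bar R}.

Definition lebesgue_cons : set (Rd R d.+1) -> \bar R :=
  pushforward (product_measure1 (@lebesgue_measure R) m) tcons.

Let lebesgue_cons0 : (lebesgue_cons set0 = 0)%E.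
Proof. by rewrite /lebesgue_cons /pushforward preimage_set0 measure0. Qed.

Let lebesgue_cons_ge0 A : (0 <= lebesgue_cons A)%E.
Proof. by rewrite /lebesgue_cons /pushforward; exact: measure_ge0. Qed.

Let lebesgue_cons_sigma_additive : semi_sigma_additive lebesgue_cons.
Proof.
move=> F mF tF mUF; rewrite /lebesgue_cons /pushforward preimage_bigcup.
apply: measure_semi_sigma_additive.
- by move=> n; rewrite -[X in measurable X]setTI; exact: measurable_tcons.
- apply/trivIsetP => /= i j _ _ ij; rewrite -preimage_setI.
  by move/trivIsetP : tF => /(_ _ _ _ _ ij) ->//; rewrite preimage_set0.
- by rewrite -preimage_bigcup -[X in measurable X]setTI; exact: measurable_tcons.
Qed.

HB.instance Definition _ := isMeasure.Build _ _ _ lebesgue_cons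
  lebesgue_cons0 lebesgue_cons_ge0 lebesgue_cons_sigma_additive.

Let uncons (t : Rd R d.+1) : measurableTypeR R * Rd R d :=
  (thead t, [tuple of behead t]).

Let tconsK : cancel tcons uncons.
Proof. by move=> [x t]; congr pair; apply/val_inj. Qed.

Let measurable_uncons : measurable_fun setT uncons.
Proof.
apply: measurable_fun_pair; last exact: measurable_behead.
exact: measurable_tnth.
Qed.

Let lebesgue_cons_sigma_finite : sigma_finite setT lebesgue_cons.
Proof.
have /sigma_finiteP[F [TF ndF Foo]] := sigma_finiteT (@lebesgue_measure R).
have /sigma_finiteP[G [TG ndG Goo]] := sigma_finiteT m.
exists (fun n => uncons @^-1` (F n `*` G n)).
  rewrite -preimage_bigcup [X in _ @^-1` X](_ : _ = setT) ?preimage_setT//.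
  apply/seteqP; split => // -[x y] _.
  have [n _ Fnx] : (\bigcup_n F n) x by rewrite -TF.
  have [k _ Gky] : (\bigcup_n G n) y by rewrite -TG.
  exists (maxn n k) => //; split => /=.
  - by move: x Fnx; exact/subsetPset/ndF/leq_maxl.
  - by move: y Gky; exact/subsetPset/ndG/leq_maxr.
move=> k; have [mF Fk] := Foo k; have [mG Gk] := Goo k; split.
  rewrite -[X in measurable X]setTI; apply: measurable_uncons => //.
  exact: measurableX.
rewrite /lebesgue_cons /pushforward -comp_preimage.
rewrite (_ : uncons \o tcons = id); last by apply/funext => p; exact: tconsK.
by rewrite preimage_id product_measure1E// lte_mul_pinfty// ge0_fin_numE.
Qed.

HB.instance Definition _ := Measure_isSigmaFinite.Build _ _ _ lebesgue_cons
  lebesgue_cons_sigma_finite.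

End lebesgue_cons.

(* Lebesgue measure on R^d: the Dirac mass on the one-point space R^0, and the
   image of the product of the two Lebesgue measures under (x, t) |-> x :: t. *)
Fixpoint lebesgue_measure_Rd (R : realType) (d : nat) :
    {sigma_finite_measure set (Rd R d) -> \bar R} :=
  match d with
  | 0 => \d_([tuple] : Rd R 0)
  | d'.+1 => lebesgue_cons (lebesgue_measure_Rd R d')
  end.

Lemma measurable_box (R : realType) (d : nat)
    (A : 'I_d -> set (measurableTypeR R)) :
  (forall i, measurable (A i)) ->
  measurable [set t : Rd R d | forall i, A i (tnth t i)].
Proof.
move=> mA; rewrite (_ : [set t | _] =
    \bigcap_i ((fun t : Rd R d => tnth t i) @^-1` A i)).
  apply: fin_bigcap_measurable => [|i _]; first exact: finite_finset.
  by rewrite -[X in measurable X]setTI; exact: measurable_tnth.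
by apply/seteqP; split => [t /= H i _|t /= H i]; exact: H.
Qed.

Lemma lebesgue_measure_Rd_box (R : realType) (d : nat)
    (A : 'I_d -> set (measurableTypeR R)) :
  (forall i, measurable (A i)) ->
  lebesgue_measure_Rd R d [set t | forall i, A i (tnth t i)] =
  (\prod_(i < d) @lebesgue_measure R (A i))%E.
Proof.
elim: d A => [|d IH] A mA; first by rewrite big_ord0 /= diracE mem_set// => -[].
rewrite big_ord_recl -(IH (fun i => A (lift ord0 i)))//=.
rewrite /lebesgue_cons /pushforward -product_measure1E//; last first.
  by apply: (@measurable_box R d (fun i => A (lift ord0 i))) => i; exact: mA.
congr (product_measure1 _ _ _); apply/seteqP; split=> [[x t] H|[x t] [/= H0 H] i].
  split; first exact: (H ord0).
  by move=> i; move: (H (lift ord0 i)); rewrite /= tnthS.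
case: (unliftP ord0 i) => [j ->|->]; last exact: H0.
by rewrite tnthS; exact: H.
Qed.

Section kernel.
Context {R : realType} {d : nat}.

Definition psd_kernel (T : Type) (k : T -> T -> R) : Prop :=
  forall (m : nat) (z : 'I_m -> T) (c : 'I_m -> R),
    0 <= \sum_(i < m) \sum_(j < m) c i * c j * k (z i) (z j).

Record smoothing_kernel (k : Rd R d -> Rd R d -> R) : Prop := {
  kernel_ge0 : forall x y, 0 <= k x y ;
  (* implicit in the existence of the next integral *)
  kernel_measurable : forall x,
    measurable_fun setT (k x : Rd R d -> measurableTypeR R) ;
  kernel_int1 : forall x,
    (\int[lebesgue_measure_Rd R d]_y (k x y)%:E = 1)%E ;
  kernel_radial : exists g0 : R -> R, forall x y, k x y = g0 (sqdist x y) ;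
  kernel_psd : psd_kernel k }.

End kernel.

(* A real reproducing kernel Hilbert space with kernel k.  Its elements are the
   functions T -> R obtained through the injective linear map rkhs_fun; the norm
   of the complete normed module is the one of the inner product.  By the
   Moore-Aronszajn theorem this determines the space up to isometry. *)
Record rkhs (R : realType) (T : Type) (k : T -> T -> R) := RKHS {
  rkhs_space :> completeNormedModType R ;
  rkhs_dot : {dot rkhs_space for idfun} ;
  rkhs_normE : forall g : rkhs_space, `|g| ^+ 2 = rkhs_dot g g ;
  rkhs_fun : {linear rkhs_space -> (T -> R^o)} ;
  rkhs_fun_inj : injective rkhs_fun ;
  feature : T -> rkhs_space ;
  rkhs_fun_feature : forall x y, rkhs_fun (feature x) y = k y x ;
  rkhs_reproducing : forall (g : rkhs_space) x,
    rkhs_dot g (feature x) = rkhs_fun g x }.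

Arguments feature {R T k} H x : rename.

Section loss.
Context {R : realType}.
Implicit Types (rho : R -> R) (x : R).

(* rho represents a function on [0, +oo[: its values at negative arguments are
   never used, and the derivative at 0 is the right derivative. *)
Definition nneg : set R := `[0, +oo[.

Definition diff_quotient rho x (y : R) : R := (rho y - rho x) / (y - x).

Definition differentiable_nneg rho : Prop :=
  forall x, 0 <= x -> cvg (diff_quotient rho x y @[y --> within nneg x^']).

Definition psi rho x : R := lim (diff_quotient rho x y @[y --> within nneg x^']).

Definition phi rho x : R :=
  if x == 0 then lim (psi rho y / y @[y --> 0^'+]) else psi rho x / x.

Record loss_A1 rho : Prop := {
  A1_nondecreasing : {in nneg &, {homo rho : x y / x <= y}} ;
  A1_0 : rho 0 = 0 ;
  A1_lim : rho x / x @[x --> 0^'+] --> (0 : R) }.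

Definition loss_A2 rho : Prop := cvg (psi rho x / x @[x --> 0^'+]).

Definition loss_A3 rho : Prop :=
  {within nneg, continuous (psi rho)} /\ {within nneg, continuous (phi rho)}.

End loss.

Section rkde.
Context {R : realType} {T : Type} {k : T -> T -> R}.
Variables (H : rkhs k) (rho : R -> R) (n : nat) (X : 'I_n -> T).

Definition risk (g : H) : R :=
  n%:R^-1 * \sum_(i < n) rho `|feature H (X i) - g|.

(* The sequences are indexed as (w k) and (f k.+1), k >= 0; f 0 is arbitrary. *)
Record kirwls (w : nat -> 'I_n -> R) (f : nat -> H) : Prop := {
  kirwls_w0_ge0 : forall i, 0 <= w 0 i ;
  kirwls_w0_sum1 : \sum_(i < n) w 0 i = 1 ;
  kirwls_f : forall m, f m.+1 = \sum_(i < n) w m i *: feature H (X i) ;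
  kirwls_w : forall m i, w m.+1 i =
    phi rho `|feature H (X i) - f m.+1| /
    \sum_(j < n) phi rho `|feature H (X j) - f m.+1| }.

End rkde.

Definition strictly_convex (R : realType) (V : lmodType R) (J : V -> R) : Prop :=
  forall (g h : V) (t : R), g != h -> 0 < t < 1 ->
    J (t *: g + (1 - t) *: h) < t * J g + (1 - t) * J h.

Definition argmin (R : realType) (V : Type) (J : V -> R) : set V :=
  [set g | forall h, J g <= J h].

(* Main.v *)
(* Since phi is nonincreasing, s |-> rho (sqrt s) is concave, so with P i the
   feature of X i, the objective L g = \sum_i rho `|P i - g| lies below the
   weighted least squares objective that touches it at g, and a KIRWLS step
   minimizes the latter (majorization-minimization).  Combined with the gradient
   inequality of the convex function L, a step from g to m satisfies, for every
   h and with S the sum of the weights at g,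
     L m <= L h + S / 2 * (`|h - g| ^+ 2 - `|h - m| ^+ 2),
   and S is at most \sum_i phi 0, so telescoping shows that the iterates form a
   minimizing sequence.  They stay in the compact image of [0, 1]^n under
   w |-> \sum_i w i *: P i, where a minimizing sequence of a strictly convex
   continuous function converges to the unique minimizer. *)
Require Import Defs.
From HB Require Import structures.
From mathcomp Require Import all_boot all_order all_algebra.
From mathcomp Require Import all_classical all_reals all_analysis.
From mathcomp Require Import ring lra.

Set Implicit Arguments.
Unset Strict Implicit.
Unset Printing Implicit Defensive.

Import Order.TTheory GRing.Theory Num.Theory.
Import numFieldNormedType.Exports.

Local Open Scope classical_set_scope.
Local Open Scope ring_scope.

(** * Scalar inequalities for the loss and its weight function *)

Section loss.
Context {R : realType} (rho : R -> R).
Hypothesis rho_diff : differentiable_nneg rho.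
Hypothesis rhoA1 : loss_A1 rho.
Hypothesis phi_noninc : {in nneg &, {homo phi rho : x y /~ x <= y}}.

Lemma in_nneg (x : R) : (x \in nneg) = (0 <= x).
Proof.
by apply/idP/idP => [/set_mem|x0]; rewrite ?inE /nneg /= in_itv /= andbT.
Qed.

(** A positive [x] has a neighbourhood inside [nneg], so the derivative relative to [nneg] is the
    ordinary one. *)
Lemma is_derive_loss (x : R) : 0 < x -> is_derive x 1 rho (psi rho x).
Proof.
move=> x0; apply/is_derive1_caratheodory.
exists (fun z => if z == x then psi rho x else diff_quotient rho x z).
rewrite eqxx; split => // [z|].
  case: eqVneq => [->|zx]; first by rewrite !subrr mulr0.
  by rewrite /diff_quotient divfK// subr_eq0.
apply/continuous_withinNx; rewrite eqxx.
have dq : diff_quotient rho x y @[y --> x^'] --> psi rho x.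
  move=> A /(rho_diff (ltW x0)); rewrite !near_simpl /= => nA.
  have nx : \forall y \near x^', nneg y.
    apply: nbhs_dnbhs; near=> y; rewrite /nneg /= in_itv /= andbT.
    by apply/ltW; near: y; exact: lt_nbhsr.
  move: nA; rewrite near_withinE => nA.
  by near=> y; apply: (near nA y) => //; near: y.
apply: cvg_trans dq; apply: near_eq_cvg; near=> y.
rewrite ifN//; near: y; exact: nbhs_dnbhs_neq.
Unshelve. all: by end_near. Qed.

Lemma continuous_loss (x : R) : 0 < x -> {for x, continuous rho}.
Proof.
move=> /is_derive_loss [dx _].
exact/differentiable_continuous/derivable1_diffP.
Qed.

Lemma loss_cvg0 : rho x @[x --> 0^'+] --> rho 0.
Proof.
rewrite (A1_0 rhoA1) -[0 in X in _ --> X](mulr0 0).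
have xx : x @[x --> (0 : R)^'+] --> (0 : R) by exact: cvg_at_right_filter.
apply: cvg_trans (cvgM (A1_lim rhoA1) xx); apply: near_eq_cvg.
near=> x; rewrite /= ?fctE divfK// gt_eqF//; near: x; exact: nbhs_right_gt.
Unshelve. all: by end_near. Qed.

Lemma within_continuous_loss (a b : R) :
  0 <= a -> a < b -> {within `[a, b], continuous rho}.
Proof.
move=> a0 ab; apply/continuous_within_itvP => //; split.
- move=> x; rewrite in_itv /= => /andP[ax _].
  by apply: continuous_loss; exact: le_lt_trans ax.
- move: a0; rewrite le_eqVlt => /predU1P[<-|a0]; first exact: loss_cvg0.
  exact/cvg_at_right_filter/continuous_loss.
- exact/cvg_at_left_filter/continuous_loss/(le_lt_trans a0).
Qed.

Lemma phi_mono (x y : R) : 0 <= x -> x <= y -> phi rho y <= phi rho x.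
Proof.
by move=> x0 xy; apply: phi_noninc; rewrite ?in_nneg// (le_trans x0).
Qed.

(* As phi is nonincreasing, s |-> rho (sqrt s) is concave; this is its tangent
   inequality at s = r ^+ 2. *)
Lemma loss_tangent (r t : R) : 0 <= r -> 0 <= t ->
  rho t <= rho r + phi rho r / 2 * (t ^+ 2 - r ^+ 2).
Proof.
move=> r0 t0; set c := phi rho r.
(* As [phi rho] is nonincreasing, [F] is nondecreasing up to [r] and nonincreasing beyond, so [r]
   maximizes it. At 0 the mean value theorem needs only continuity. *)
pose F x := rho x - c / 2 * x ^+ 2.
have dF (x : R) : 0 < x -> is_derive x 1 F (x * (phi rho x - c)).
  move=> x0; have dx := is_derive_loss x0.
  have -> : x * (phi rho x - c) = psi rho x - c / 2 * (2 * x).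
    by rewrite /phi gt_eqF//; field; rewrite gt_eqF.
  have -> : F = rho - (c / 2) \*: (id ^+ 2).
    by apply/funext => y; rewrite /F !fctE.
  apply: is_derive_eq.
  by rewrite /GRing.scale /= expr1 mulr1.
have cF a b : 0 <= a -> a < b -> {within `[a, b], continuous F}.
  move=> a0 ab x; apply: cvgB; first exact: (within_continuous_loss a0 ab).
  apply: cvgMr.
  suff : {within `[a, b], continuous (fun x : R => x ^+ 2)} by exact.
  by apply: continuous_subspaceT => y; exact: exprn_continuous.
have mvt a b : 0 <= a -> a < b ->
    exists2 y, a < y < b & F b - F a = y * (phi rho y - c) * (b - a).
  move=> a0 ab.
  have [|y] := @MVT _ F (fun y => y * (phi rho y - c)) _ _ ab _ (cF _ _ a0 ab).
    move=> y; rewrite in_itv /= => /andP[ay _].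
    by apply: dF; exact: le_lt_trans ay.
  by rewrite in_itv; exists y.
suff : F t <= F r by rewrite /F; lra.
have [rt|tr|->//] := ltgtP r t.
  have [y /andP[ry yt] E] := mvt _ _ r0 rt.
  have y0 : 0 <= y by apply: (le_trans r0); exact: ltW.
  rewrite -subr_le0 E mulr_le0_ge0//; last by rewrite subr_ge0 ltW.
  by rewrite mulr_ge0_le0// subr_le0; apply/phi_mono/ltW.
have [y /andP[ty yr] E] := mvt _ _ t0 tr.
have y0 : 0 <= y by apply: (le_trans t0); exact: ltW.
rewrite -subr_ge0 E !mulr_ge0// subr_ge0; last exact: ltW.
exact/phi_mono/ltW.
Qed.

(** By monotonicity the tangent bound at [x], evaluated at [x + 1], cannot fall below [rho x]. *)
Lemma phi_ge0 (x : R) : 0 <= x -> 0 <= phi rho x.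
Proof.
move=> x0; rewrite -(pmulr_lge0 _ (_ : 0 < (x + 1) ^+ 2 - x ^+ 2)); last by nra.
have := loss_tangent x0 (addr_ge0 x0 ler01).
have := A1_nondecreasing rhoA1
  (_ : x \in nneg) (_ : x + 1 \in nneg) (_ : x <= x + 1).
rewrite !in_nneg lerDl ler01 addr_ge0// => /(_ x0 isT isT).
lra.
Qed.

Lemma phi_eq0_cst (x y : R) :
  0 <= x -> phi rho x = 0 -> x <= y -> rho y = rho x.
Proof.
move=> x0 px xy; have y0 := le_trans x0 xy; apply/eqP; rewrite eq_le.
have := loss_tangent x0 y0; rewrite px !mul0r addr0 => ->.
by rewrite (A1_nondecreasing rhoA1)// in_nneg.
Qed.

(** The slopes of s |-> rho (sqrt s) are at most [phi rho 0 / 2]. This yields continuity of the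
    objective, even where [P i - g] vanishes. *)
Lemma loss_dist (r t : R) : 0 <= r -> 0 <= t ->
  `|rho t - rho r| <= phi rho 0 / 2 * `|t ^+ 2 - r ^+ 2|.
Proof.
wlog rt : r t / r <= t.
  move=> H r0 t0; have [|/ltW] := leP r t; first by move/H; apply.
  by move/H => /(_ t0 r0); rewrite distrC [in leRHS]distrC.
move=> r0 t0; rewrite !ger0_norm ?subr_ge0.
- have := loss_tangent r0 t0; rewrite -lerBlDl => /le_trans; apply.
  rewrite ler_wpM2r ?subr_ge0 ?ler_pM2r ?phi_mono// ?ler_sqr ?nnegrE//.
- by rewrite ler_sqr ?nnegrE.
- by rewrite (A1_nondecreasing rhoA1)// in_nneg.
Qed.

End loss.

(** * Squared-norm identities in an inner product space *)

Section dot_norm.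
Context {R : realType} {V : normedModType R} (dot : {dot V for idfun}).
Hypothesis normE : forall g : V, `|g| ^+ 2 = dot g g.

Lemma sqnormB (u v : V) : `|u - v| ^+ 2 = `|u| ^+ 2 + `|v| ^+ 2 - 2 * dot u v.
Proof. by rewrite !normE hnormB /= expr0 mul1r -mulr2n mulr_natl. Qed.

(** Stewart's theorem for a point of the line through [a] and [a - v]. *)
Lemma sqnormB_scale (a v : V) (t : R) :
  `|a - t *: v| ^+ 2 =
  (1 - t) * `|a| ^+ 2 + t * `|a - v| ^+ 2 - t * (1 - t) * `|v| ^+ 2.
Proof.
rewrite !sqnormB linearZr_LR /= normrZ exprMn real_normK ?num_real//. ring.
Qed.

(** Parallel axis identity, with the barycenter condition kept free of division by the total
    weight. *)
Lemma sum_sqnorm_barycenter (I : finType) (c : I -> R) (P : I -> V) (m h : V) :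
  \sum_i c i *: P i = (\sum_i c i) *: m ->
  \sum_i c i * `|P i - h| ^+ 2 =
  \sum_i c i * `|P i - m| ^+ 2 + (\sum_i c i) * `|h - m| ^+ 2.
Proof.
move=> cm.
have dotc u : \sum_i c i * dot (P i) u = (\sum_i c i) * dot m u.
  rewrite -[RHS]linearZl_LR -cm linear_sumlz/=.
  by apply: eq_bigr => i _; rewrite linearZl_LR.
have E u : \sum_i c i * `|P i - u| ^+ 2 =
    \sum_i c i * `|P i| ^+ 2 + (\sum_i c i) * (`|u| ^+ 2 - 2 * dot m u).
  rewrite mulrBr (mulrCA _ 2) -dotc mulr_suml mulr_sumr -sumrB -big_split.
  by apply: eq_bigr => i _ /=; rewrite sqnormB; ring.
rewrite !E [`|h - m| ^+ 2]sqnormB -normE hermC /= expr0 mul1r.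
ring.
Qed.

End dot_norm.

(** * Minimizing sequences of strictly convex functions *)

Section minimizing_sequence.
Context {R : realType} {V : normedModType R} (J : V -> R).
Hypothesis J_cont : continuous J.
Hypothesis J_convex : strictly_convex J.

Lemma strictly_convex_argmin_uniq (g h : V) :
  argmin J g -> argmin J h -> g = h.
Proof.
move=> Jg Jh; apply/eqP/negPn/negP => gh.
have t01 : (0 < 2^-1 :> R) && (2^-1 < 1 :> R) by lra.
have := J_convex gh t01.
have := Jg (2^-1 *: g + (1 - 2^-1) *: h); have := Jh g; have := Jg h; lra.
Qed.

(** A minimum over [K] is global, because [f] is eventually in [K] and its values there drop below
    every [J h + e]. *)
Lemma minimizing_sequence_cvg (K : set V) (f : nat -> V) :
  compact K -> (\forall m \near \oo, K (f m)) ->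
  (forall h (e : R), 0 < e -> \forall m \near \oo, J (f m) < J h + e) ->
  exists fhat, argmin J = [set fhat] /\ f m @[m --> \oo] --> fhat.
Proof.
move=> cK Kf Jf.
have [m Km] : exists m, K (f m) := filter_ex Kf.
have K0 : K !=set0 by exists (f m).
have [fhat _ fhat_min] := compact_EVT_min K0 cK (continuous_subspaceT J_cont).
have Jfhat : argmin J fhat.
  move=> h; rewrite leNgt; apply/negP => Jh.
  have e0 : 0 < J fhat - J h by rewrite subr_gt0.
  have [k [Kk]] := filter_ex (filterI Kf (Jf h _ e0)).
  by rewrite subrKC ltNge fhat_min// inE.
exists fhat; split.
  apply/seteqP; split => [g Jg|_ ->//]; exact: strictly_convex_argmin_uniq.
apply/cvgrPdist_lt => e e0.
(* The minimum of [J] on [Ke], if [Ke] is nonempty, exceeds [J fhat]; this gap is the tolerance that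
   keeps [f m] out of [Ke]. *)
pose Ke := K `&` [set g | e <= `|fhat - g|].
have cKe : compact Ke.
  have cn : continuous (fun g : V => `|fhat - g|).
    by move=> x; apply: cvg_norm; apply: cvgB => //; exact: cvg_cst.
  apply: compact_closedI => //.
  by move/continuous_closedP : cn => /(_ _ (@closed_ge R e)).
have [Ke0|Ke0] := pselect (Ke !=set0); last first.
  apply: filterS Kf => k Kk; rewrite ltNge; apply/negP => ek.
  by apply: Ke0; exists (f k).
have [g /set_mem[_ /= eg] g_min] :=
  compact_EVT_min Ke0 cKe (continuous_subspaceT J_cont).
have Jg : 0 < J g - J fhat.
  rewrite subr_gt0 lt_neqAle Jfhat andbT; apply/eqP => Jfg.
  have gfhat : g = fhat.
    by apply: strictly_convex_argmin_uniq => // h; rewrite -Jfg.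
  by move: eg; rewrite gfhat subrr normr0 leNgt e0.
apply: filterS2 Kf (Jf fhat _ Jg) => k Kk; rewrite subrKC => Jfk.
rewrite ltNge; apply/negP => ek; move: Jfk; rewrite ltNge g_min// inE.
by split.
Qed.

End minimizing_sequence.

(** * Majorization-minimization for a sum of losses *)

Section majorization.
Context {R : realType} {V : normedModType R} (dot : {dot V for idfun}).
Hypothesis normE : forall g : V, `|g| ^+ 2 = dot g g.
Context {I : finType} (P : I -> V) (rho : R -> R).
Hypothesis rho_diff : differentiable_nneg rho.
Hypothesis rhoA1 : loss_A1 rho.
Hypothesis phi_cont : {within nneg, continuous (phi rho)}.
Hypothesis phi_noninc : {in nneg &, {homo phi rho : x y /~ x <= y}}.

Let L (g : V) : R := \sum_i rho `|P i - g|.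
Let c (g : V) (i : I) : R := phi rho `|P i - g|.

Lemma sum_loss_majorize (g h : V) :
  L h <= L g + 2^-1 * \sum_i c g i * (`|P i - h| ^+ 2 - `|P i - g| ^+ 2).
Proof.
rewrite mulr_sumr -big_split ler_sum// => i _ /=.
have := loss_tangent rho_diff rhoA1 phi_noninc
  (normr_ge0 (P i - g)) (normr_ge0 (P i - h)).
by rewrite mulrA (mulrC 2^-1).
Qed.

Lemma continuous_sum_loss : continuous L.
Proof.
move=> g; apply: cvg_big => [|i _]; first exact: add_continuous.
apply/cvgrPdist_le => e e0.
set M := phi rho 0 / 2.
have M0 : 0 <= M by rewrite divr_ge0// (phi_ge0 rho_diff rhoA1 phi_noninc).
have cn : (M * `| `|P i - g| ^+ 2 - `|P i - h| ^+ 2|) @[h --> g] --> (0 : R).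
  rewrite -[X in _ --> X](mulr0 M) -[X in _ --> M * X](@normr0 R R).
  apply: cvgMr; apply: cvg_norm; rewrite -(subrr (`|P i - g| ^+ 2)).
  apply: cvgB; first exact: cvg_cst.
  apply: (@continuous_comp _ _ _ (fun h => `|P i - h|) (fun x : R => x ^+ 2)).
    apply: cvg_norm; apply: cvgB => //; exact: cvg_cst.
  exact: exprn_continuous.
near=> h; apply: le_trans (loss_dist rho_diff rhoA1 phi_noninc _ _) _ => //.
rewrite -/M; near: h.
exact: (cvgr_le _ cn).
Unshelve. all: by end_near. Qed.

Lemma continuous_phi_norm (u : V) :
  {for u, continuous (phi rho \o @Num.norm _ V)}.
Proof.
move: phi_cont => /subspace_continuousP /(_ `|u|).
rewrite {1}/nneg /= in_itv /= normr_ge0 => /(_ isT) + A Aphi => /(_ _ Aphi).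
rewrite !near_simpl !near_withinE => nA.
have := @norm_continuous _ V u _ nA; rewrite !near_simpl => nA'.
by near=> v; apply: (near nA' v) => //; rewrite /nneg /= in_itv /= normr_ge0.
Unshelve. all: by end_near. Qed.

Hypothesis L_convex : forall (g h : V) (t : R), g != h -> 0 < t < 1 ->
  L (t *: g + (1 - t) *: h) <= t * L g + (1 - t) * L h.

(** The added term is - \sum_i c g i * dot (P i - g) (h - g), the directional derivative of [L] at
    [g] towards [h]. It is reached as a limit of majorizations, without differentiating [L]. *)
Lemma sum_loss_gradient (g h : V) :
  L g + 2^-1 *
    \sum_i c g i * (`|P i - h| ^+ 2 - `|P i - g| ^+ 2 - `|h - g| ^+ 2) <= L h.
Proof.
have [->|hg] := eqVneq h g.
  rewrite big1 ?mulr0 ?addr0// => i _.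
  by rewrite !subrr normr0 expr0n subrr mulr0.
rewrite -lerBrDl; set v := h - g.
(* Majorizing at [g + t *: v] and evaluating at [g] gives [t * E t <= L (g + t *: v) - L g], which
   convexity bounds by [t * (L h - L g)]. Divide by [t] and let it tend to 0. *)
pose E (t : R) := 2^-1 * \sum_i c (g + t *: v) i *
  (`|P i - h| ^+ 2 - `|P i - g| ^+ 2 - (1 - t) * `|v| ^+ 2).
have E0 : E 0 = 2^-1 *
    \sum_i c g i * (`|P i - h| ^+ 2 - `|P i - g| ^+ 2 - `|h - g| ^+ 2).
  by rewrite /E scale0r addr0 subr0 mul1r.
rewrite -E0.
have cE : E t @[t --> (0 : R)^'+] --> E 0.
  apply: cvg_at_right_filter; apply: cvgMr.
  apply: cvg_big => [|i _]; first exact: add_continuous.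
  apply: cvgM; last first.
    apply: cvgB; first exact: cvg_cst.
    by apply: cvgMl; apply: cvgB => //; exact: cvg_cst.
  apply: (@continuous_comp _ _ _ (fun t : R => P i - (g + t *: v))
    (phi rho \o @Num.norm _ V)).
    apply: cvgB; first exact: cvg_cst.
    apply: cvgD; first exact: cvg_cst.
    exact: cvgZl.
  exact: continuous_phi_norm.
suff : \forall t \near (0 : R)^'+, E t <= L h - L g by exact: cvgr_to_le cE.
near=> t.
have t0 : 0 < t by near: t; exact: nbhs_right_gt.
have t1 : t < 1 by near: t; exact: nbhs_right_lt.
have t01 : 0 < t < 1 by rewrite t0.
have eu : t *: h + (1 - t) *: g = g + t *: v.
  by rewrite /v scalerBr scalerBl scale1r addrCA.
have := L_convex hg t01; rewrite eu.
have := sum_loss_majorize (g + t *: v) g.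
have -> : \sum_i c (g + t *: v) i *
    (`|P i - g| ^+ 2 - `|P i - (g + t *: v)| ^+ 2)
  = - t * \sum_i c (g + t *: v) i *
  (`|P i - h| ^+ 2 - `|P i - g| ^+ 2 - (1 - t) * `|v| ^+ 2).
  rewrite mulr_sumr; apply: eq_bigr => i _.
  rewrite opprD addrA (sqnormB_scale normE (P i - g)).
  have -> : P i - g - v = P i - h by rewrite /v opprB addrA subrK.
  ring.
rewrite /E; set S := \sum_i _ => H1 H2.
rewrite -(ler_pM2l t0); lra.
Unshelve. all: by end_near. Qed.

(** The majorization gains a multiple of [|g - m| ^+ 2], which cancels the same term that the
    gradient inequality produces once both sums are recentred at [m]. *)
Lemma sum_loss_barycenter_step (g m h : V) :
  \sum_i c g i *: P i = (\sum_i c g i) *: m ->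
  L m <= L g /\
  L m <= L h + 2^-1 * (\sum_i c g i) * (`|h - g| ^+ 2 - `|h - m| ^+ 2).
Proof.
move=> cm.
have c0 : 0 <= \sum_i c g i.
  by apply: sumr_ge0 => i _; rewrite (phi_ge0 rho_diff rhoA1 phi_noninc).
have Lm : L m <= L g - 2^-1 * (\sum_i c g i) * `|g - m| ^+ 2.
  have := sum_loss_majorize g m.
  under eq_bigr do rewrite mulrBr.
  rewrite sumrB (sum_sqnorm_barycenter normE g cm); lra.
have Lh := sum_loss_gradient g h.
split.
  by have : 0 <= (\sum_i c g i) * `|g - m| ^+ 2; [exact: mulr_ge0|lra].
move: Lh; under eq_bigr do rewrite 2!mulrBr.
rewrite 2!sumrB (sum_sqnorm_barycenter normE g cm).
rewrite (sum_sqnorm_barycenter normE h cm).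
rewrite -mulr_suml; lra.
Qed.

(** By descent, one value below [L h + e] suffices. Otherwise each step decreases
    [M * |h - f k| ^+ 2] by at least [e], which cannot go on forever. *)
Lemma sum_loss_iterates_minimizing (f : nat -> V) :
  (forall k, \sum_i c (f k) i *: P i = (\sum_i c (f k) i) *: f k.+1) ->
  forall h (e : R), 0 < e -> \forall k \near \oo, L (f k) < L h + e.
Proof.
move=> fE h e e0.
pose M : R := 2^-1 * (\sum_(i : I) phi rho 0).
have phi00 : 0 <= phi rho 0 by rewrite (phi_ge0 rho_diff rhoA1 phi_noninc).
have M0 : 0 <= M by rewrite mulr_ge0// sumr_ge0.
have L_noninc k : L (f k.+1) <= L (f k).
  by have [] := sum_loss_barycenter_step h (fE k).
have Lmono : {homo (L \o f) : j k / (j <= k)%N >-> k <= j}.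
  by apply: homo_leq => // x y z xy yz; exact: le_trans xy.
have [k Lk] : exists k, L (f k) < L h + e.
  apply: contrapT => /forallNP Lf.
  have {}Lf k : L h + e <= L (f k) by rewrite leNgt; apply/negP/Lf.
  have D k : e *+ k <= M * (`|h - f 0| ^+ 2 - `|h - f k| ^+ 2).
    elim: k => [|k IH]; first by rewrite subrr mulr0.
    have [_ Lm] := sum_loss_barycenter_step h (fE k).
    have Lk := Lf k.+1.
    set d := `|h - f k| ^+ 2 - `|h - f k.+1| ^+ 2 in Lm.
    have cM : 2^-1 * \sum_i c (f k) i <= M.
      by rewrite ler_wpM2l// ler_sum// => i _; exact: phi_mono.
    have ck0 : 0 <= 2^-1 * \sum_i c (f k) i.
      rewrite mulr_ge0// sumr_ge0// => i _.
      by rewrite (phi_ge0 rho_diff rhoA1 phi_noninc).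
    (* Positivity of [e] rules out [d < 0], so the half-sum of weights may be enlarged to [M]. *)
    have ed : e <= M * d.
      have ed' : e <= 2^-1 * (\sum_i c (f k) i) * d by lra.
      apply: le_trans ed' _; rewrite ler_wpM2r//.
      rewrite leNgt; apply/negP => d0.
      have : 2^-1 * (\sum_i c (f k) i) * d <= 0 by rewrite mulr_ge0_le0// ltW.
      by lra.
    rewrite mulrS; apply: le_trans (lerD ed IH) _.
    by rewrite /d -mulrDr addrC addrA subrK.
  have /archi_boundP : 0 <= M * `|h - f 0| ^+ 2 / e.
    by apply: divr_ge0; [exact/mulr_ge0/sqr_ge0|exact: ltW].
  set N := Num.bound _; rewrite ltr_pdivrMr// => NM.
  have := D N; rewrite -mulr_natl.
  have : 0 <= M * `|h - f N| ^+ 2 by rewrite mulr_ge0 ?sqr_ge0.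
  lra.
near=> j; apply: le_lt_trans Lk; apply: Lmono; near: j; exact: nbhs_infty_ge.
Unshelve. all: by end_near. Qed.

End majorization.

(** A continuous image of a finite-dimensional cube; closed balls of [V] itself need not be
    compact. *)
Lemma compact_zonotope (R : realType) (V : normedModType R) (n : nat)
    (P : 'I_n -> V) :
  compact [set \sum_i w i *: P i |
    w in [set w : 'I_n -> R | forall i, 0 <= w i <= 1]].
Proof.
pose B := [set v : 'rV[R]_n | forall i, `[0, 1]%classic (v ord0 i)].
rewrite (_ : [set _ | _ in _] =
    [set \sum_i v ord0 i *: P i | v in B]); last first.
  apply/seteqP; split=> _ [w w01 <-].
  - exists (\row_i w i); last by apply: eq_bigr => i _; rewrite mxE.
    by move=> i; rewrite mxE /= in_itv /= w01.
  - by exists (w ord0) => // i; have := w01 i; rewrite /= in_itv.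
have cB : compact B.
  apply: (@rV_compact R n (fun=> `[0, 1]%classic)) => _; exact: segment_compact.
apply: continuous_compact cB.
apply: continuous_subspaceT => v.
apply: (@cvg_big _ _ _ _ _ _ _ (nbhs v)) => [|i _].
  exact: add_continuous.
apply: (@continuous_comp _ _ _
  (fun v : 'rV[R]_n => v ord0 i) (fun x => x *: P i)).
  exact: coord_continuous.
exact: scalel_continuous.
Qed.

(** * Strict positivity of the weights *)

Section positivity.
Context {R : realType} {V : normedModType R} {n : nat} (P : 'I_n -> V).
Context (rho : R -> R).
Hypothesis rho_diff : differentiable_nneg rho.
Hypothesis rhoA1 : loss_A1 rho.
Hypothesis phi_noninc : {in nneg &, {homo phi rho : x y /~ x <= y}}.
Hypothesis J_convex :
  strictly_convex (fun g : V => \sum_i rho `|P i - g|).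

(* If phi vanishes at x, then rho is constant beyond x, so that the objective is
   constant on a far end of any line, against strict convexity. *)
Lemma phi_gt0 (v : V) (x : R) : v != 0 -> 0 <= x -> 0 < phi rho x.
Proof.
move=> v0 x0; rewrite lt_neqAle (phi_ge0 rho_diff rhoA1 phi_noninc)// andbT.
apply/eqP => /esym px.
have nv0 : 0 < `|v| by rewrite normr_gt0.
(* From [s0] on, the norm of [s *: v] is at least [x] plus that of any [P i]. *)
pose s0 := (x + \sum_i `|P i|) / `|v|.
have s00 : 0 <= s0 by rewrite divr_ge0// addr_ge0// sumr_ge0.
have far s : s0 <= s -> \sum_i rho `|P i - s *: v| = \sum_(i < n) rho x.
  move=> s0s; apply: eq_bigr => i _.
  apply: (phi_eq0_cst rho_diff rhoA1 phi_noninc) => //.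
  have s_ge0 := le_trans s00 s0s.
  rewrite distrC; apply: le_trans (lerB_dist _ _).
  rewrite normrZ ger0_norm// lerBrDr.
  move: s0s; rewrite ler_pdivrMr//; apply: le_trans.
  by rewrite lerD2l (bigD1 i)//= lerDl sumr_ge0.
have s01 : s0 *: v != (s0 + 1) *: v.
  by rewrite -subr_eq0 -scalerBl scaler_eq0 negb_or v0 andbT; lra.
have t01 : (0 < 2^-1 :> R) && (2^-1 < 1 :> R) by lra.
have := J_convex s01 t01; rewrite !scalerA -scalerDl !far; lra.
Qed.

End positivity.

(** * Convergence of the KIRWLS iterates to the minimizer *)

Theorem corollary1 (R : realType) (d n : nat) (k : Rd R d -> Rd R d -> R)
    (H : rkhs k) (rho : R -> R) (X : 'I_n -> Rd R d)
    (w : nat -> 'I_n -> R) (f : nat -> H) :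
  smoothing_kernel k ->
  differentiable_nneg rho ->
  loss_A1 rho -> loss_A2 rho -> loss_A3 rho ->
  {in nneg &, {homo phi rho : x y /~ x <= y}} ->
  strictly_convex (risk rho X : H -> R) ->
  kirwls rho X w f ->
  exists fhat : H,
    argmin (risk rho X : H -> R) = [set fhat] /\ f m @[m --> \oo] --> fhat.
Proof.
move=> _ rho_diff rhoA1 _ [_ phi_cont] phi_noninc J_convex.
move=> [w0_ge0 w0_sum fE wE].
(* In the zero space strict convexity is vacuous and the weights may vanish, but convergence is
   trivial. Otherwise [v] feeds [phi_gt0]. *)
have [H0|/existsNP[v /eqP v0]] := pselect (forall g : H, g = 0).
  exists 0; split.
    by apply/seteqP; split=> [g _/=|g _ h]; rewrite ?(H0 g) ?(H0 h).
  rewrite (_ : f = cst 0); first exact: cvg_cst.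
  by apply/funext => m; exact: H0.
pose P i := feature H (X i); pose L (g : H) := \sum_i rho `|P i - g|.
have n0 : (0 < n)%N.
  case: posnP => // n0; move: w0_sum; rewrite big1 => [/esym/eqP|i _].
    by rewrite oner_eq0.
  by have := ltn_ord i; rewrite [X in (_ < X)%N]n0.
have nR0 : 0 < n%:R :> R by rewrite ltr0n.
have LE g : L g = n%:R * risk rho X g by rewrite mulVKf// gt_eqF.
have L_strict : strictly_convex L.
  move=> g h t gh t01; rewrite !LE ![_ * (n%:R * _)]mulrCA -mulrDr ltr_pM2l//.
  exact: J_convex.
have L_convex (g h : H) (t : R) : g != h -> 0 < t < 1 ->
  L (t *: g + (1 - t) *: h) <= t * L g + (1 - t) * L h.
  by move=> gh t01; apply/ltW/L_strict.
have phi0 (x : R) : 0 <= x -> 0 < phi rho x.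
  exact: (phi_gt0 rho_diff rhoA1 phi_noninc L_strict v0).
(* A zero denominator would make the normalized weights take the default value 0. *)
have S0 m : 0 < \sum_i phi rho `|P i - f m|.
  rewrite (bigD1 (Ordinal n0))//= ltr_wpDr ?phi0//.
  by rewrite sumr_ge0// => i _; apply/ltW/phi0.
have w01 m i : 0 <= w m i <= 1.
  case: m => [|m].
    rewrite w0_ge0 /= -w0_sum (bigD1 i)//= lerDl sumr_ge0//.
  rewrite wE; apply/andP; split.
    by apply/ltW/divr_gt0; [exact: phi0|exact: S0].
  rewrite ler_pdivrMr ?S0// mul1r.
  by rewrite (bigD1 i)//= lerDl sumr_ge0// => j _; apply/ltW/phi0.
(* Since [f 0] is arbitrary, the argument runs on the shifted sequence [f m.+1]; [cvg_shiftS] undoes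
   the shift at the end. *)
have barycenter m : \sum_i phi rho `|P i - f m.+1| *: P i =
    (\sum_i phi rho `|P i - f m.+1|) *: f m.+2.
  rewrite (fE m.+1) scaler_sumr; apply: eq_bigr => i _.
  by rewrite wE scalerA mulrC divfK// gt_eqF.
have argminE : argmin (risk rho X : H -> R) = argmin L.
  have Lle g h : (risk rho X g <= risk rho X h) = (L g <= L h).
    by rewrite ler_pM2l// invr_gt0.
  by apply/seteqP; split => g Jg h; have := Jg h; rewrite Lle.
rewrite argminE.
have L_cont : continuous L.
  exact: (continuous_sum_loss rho_diff rhoA1 phi_noninc).
have hull : \forall m \near \oo, [set \sum_i w i *: P i |
    w in [set w : 'I_n -> R | forall i, 0 <= w i <= 1]] (f m.+1).
  by near=> m; exists (w m); rewrite ?fE.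
have minimizing := sum_loss_iterates_minimizing (@rkhs_normE _ _ _ H) rho_diff
  rhoA1 phi_cont phi_noninc L_convex barycenter.
have [fhat [Lfhat f_fhat]] :=
  minimizing_sequence_cvg L_cont L_strict (@compact_zonotope R H n P)
    hull minimizing.
by exists fhat; split => //; rewrite -cvg_shiftS.
Unshelve. all: by end_near. Qed.
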